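(* Let $\Gamma$ be an abelian group with identity $e$ and let $R$ be a $\Gamma$-graded ring. Then $p\mathfrak{Der}^{gh}_\Gamma(R)$ forms a $Z(R)\cap R_e$-module under pointwise addition and the scalar multiplication $r\cdot(F,d)_h=(rF,rd)_h$ for $r\in Z(R)\cap R_e$.
   Context: A ring $R$ is $\Gamma$-graded if $R=\bigoplus_{\tau\in\Gamma}R_\tau$ as additive groups with $R_\tau R_\sigma\subseteq R_{\tau\sigma}$. $Z(R)$ is the center of $R$. $p\mathfrak{Der}^{gh}_\Gamma(R)$ is the set of gr-generalized derivations of $R$: pairs $(F,d)_h$ where $d:R\to R$ is a derivation (additive, $d(xy)=d(x)y+xd(y)$), $F:R\to R$ is additive with $F(xy)=F(x)y+xd(y)$ for all $x,y\in R$, and $F(R_\tau)\subseteq R_\tau$, $d(R_\tau)\subseteq R_\tau$ for all $\tau\in\Gamma$. Addition is $(F_1,d_1)_h+(F_2,d_2)_h=(F_1+F_2,d_1+d_2)_h$, and $(rF)(x)=r\,F(x)$, $(rd)(x)=r\,d(x)$. *)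

(* Defs.v *)
From mathcomp Require Import all_boot ssralg.
From mathcomp Require Import classical_sets.

Set Implicit Arguments.
Unset Strict Implicit.
Unset Printing Implicit Defensive.

Import GRing.Theory.
Local Open Scope classical_set_scope.
Local Open Scope ring_scope.

(* An associative ring that need not have an identity is given as an additive
   group R : zmodType with a multiplication mul : R -> R -> R.  Rings with
   identity (R : pzRingType) are the case mul := *%R. *)
Record is_ring (R : zmodType) (mul : R -> R -> R) : Prop := IsRing {
  ring_mulA : associative mul;
  ring_mulDl : left_distributive mul +%R;
  ring_mulDr : right_distributive mul +%R }.

Definition is_identity (R : Type) (mul : R -> R -> R) (u : R) : Prop :=
  left_id u mul /\ right_id u mul.

Definition ring_center (R : Type) (mul : R -> R -> R) : set R :=
  [set r | forall x, mul r x = mul x r].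

Record is_subring (R : zmodType) (mul : R -> R -> R) (S : set R) : Prop :=
  IsSubring {
    subring0 : S 0;
    subringB : forall x y, S x -> S y -> S (x - y);
    subringM : forall x y, S x -> S y -> S (mul x y) }.

(* [grading_span] and [grading_indep] together say that R is the internal
   direct sum of the subgroups [Gr t]; G may be infinite, so sums range over
   finite duplicate-free sequences of degrees. *)
Record is_grading (G : groupType) (R : zmodType) (mul : R -> R -> R)
    (Gr : G -> set R) : Prop := IsGrading {
  grading0 : forall t, Gr t 0;
  gradingB : forall t x y, Gr t x -> Gr t y -> Gr t (x - y);
  grading_span : forall x, exists s : seq G, exists c : G -> R,
    [/\ uniq s, forall t, Gr t (c t) & x = \sum_(t <- s) c t];
  grading_indep : forall (s : seq G) (c : G -> R),
    uniq s -> (forall t, Gr t (c t)) ->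
    \sum_(t <- s) c t = 0 -> forall t, t \in s -> c t = 0;
  gradingM : forall t u x y, Gr t x -> Gr u y -> Gr (t * u)%g (mul x y) }.

Record is_derivation (R : zmodType) (mul : R -> R -> R) (d : R -> R) : Prop :=
  IsDerivation {
    derivationD : {morph d : x y / x + y};
    derivationM : forall x y, d (mul x y) = mul (d x) y + mul x (d y) }.

Record is_gr_gen_der (G : groupType) (R : zmodType) (mul : R -> R -> R)
    (Gr : G -> set R) (F d : R -> R) : Prop := IsGrGenDer {
  gr_gen_der_d : is_derivation mul d;
  gr_gen_derD : {morph F : x y / x + y};
  gr_gen_derM : forall x y, F (mul x y) = mul (F x) y + mul x (d y);
  gr_gen_der_gradedF : forall t x, Gr t x -> Gr t (F x);
  gr_gen_der_gradedd : forall t x, Gr t x -> Gr t (d x) }.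

Definition pDer (G : groupType) (R : zmodType) (mul : R -> R -> R)
    (Gr : G -> set R) : set ((R -> R) * (R -> R)) :=
  [set f | is_gr_gen_der mul Gr f.1 f.2].

Definition pDer_add (R : zmodType) (f g : (R -> R) * (R -> R)) :
    (R -> R) * (R -> R) :=
  (fun x => f.1 x + g.1 x, fun x => f.2 x + g.2 x).

Definition pDer_scale (R : Type) (mul : R -> R -> R) (r : R)
    (f : (R -> R) * (R -> R)) : (R -> R) * (R -> R) :=
  (fun x => mul r (f.1 x), fun x => mul r (f.2 x)).

Record is_abelian_group_on (M : Type) (D : set M) (add : M -> M -> M) : Prop :=
  IsAbelianGroupOn {
    abgroup_closed : forall f g, D f -> D g -> D (add f g);
    abgroupA : forall f g h, D f -> D g -> D h ->
      add f (add g h) = add (add f g) h;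
    abgroupC : forall f g, D f -> D g -> add f g = add g f;
    abgroup_zero_opp : exists2 z, D z &
      forall f, D f -> add z f = f /\ exists2 g, D g & add g f = z }.

(* D is a left module over the subring S of (R, mul).  As S need not have an
   identity, the axiom 1 . f = f is not part of this record. *)
Record is_module_on (R : zmodType) (mul : R -> R -> R) (S : set R)
    (M : Type) (D : set M) (add : M -> M -> M) (scale : R -> M -> M) : Prop :=
  IsModuleOn {
    module_subring : is_subring mul S;
    module_abgroup : is_abelian_group_on D add;
    module_closed : forall r f, S r -> D f -> D (scale r f);
    module_scaleA : forall r s f, S r -> S s -> D f ->
      scale (mul r s) f = scale r (scale s f);
    module_scaleDl : forall r s f, S r -> S s -> D f ->
      scale (r + s) f = add (scale r f) (scale s f);
    module_scaleDr : forall r f g, S r -> D f -> D g ->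
      scale r (add f g) = add (scale r f) (scale r g) }.

(* Main.v *)
Require Import Defs.
From mathcomp Require Import all_boot ssralg.
From mathcomp Require Import classical_sets boolp.

(** Everything in the module structure is checked pointwise, because addition
    and scaling of pairs are pointwise. The conditions on a pair (F, d) say
    that F and d are both additive degree-preserving maps obeying a Leibniz
    rule whose second term uses d: this is [leibniz_pair] for (F, d) and for
    (d, d). The sets of such maps are stable under sums and opposites, and
    under scaling by r as soon as r is central (to move r past x in x d(y))
    and of degree 1 (to preserve degrees).

    The one point with content is that an identity u of R has degree 1
    ([identity_in_Gr1]), so that unitality of the action makes sense. If e is
    the degree 1 component of u, comparing components of degree a in x = u x
    for x of degree a gives x = e x ([component1_mull]). Homogeneous elements
    span R, so e is a left identity, and e = e u = u. *)

Set Implicit Arguments.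
Unset Strict Implicit.

Import GRing.Theory.
Local Open Scope classical_set_scope.
Local Open Scope ring_scope.

(** * Additive maps and rings without identity *)

Lemma additive0 (U V : zmodType) (f : U -> V) :
  {morph f : x y / x + y} -> f 0 = 0.
Proof. by move=> fD; apply: (addrI (f 0)); rewrite -fD !addr0. Qed.

Lemma additiveN (U V : zmodType) (f : U -> V) :
  {morph f : x y / x + y} -> {morph f : x / - x}.
Proof.
by move=> fD x; apply: (addrI (f x)); rewrite -fD !subrr (additive0 fD).
Qed.

Lemma ring_mull_additive (R : zmodType) (mul : R -> R -> R) (r : R) :
  is_ring mul -> {morph mul r : x y / x + y}.
Proof. by move=> Rring x y; apply: ring_mulDr. Qed.

Lemma ring_mulr_additive (R : zmodType) (mul : R -> R -> R) (r : R) :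
  is_ring mul -> {morph mul^~ r : x y / x + y}.
Proof. by move=> Rring x y; apply: ring_mulDl. Qed.

Lemma ring_mul0l (R : zmodType) (mul : R -> R -> R) (x : R) :
  is_ring mul -> mul 0 x = 0.
Proof. by move=> Rring; exact: additive0 (ring_mulr_additive x Rring). Qed.

Lemma ring_mul0r (R : zmodType) (mul : R -> R -> R) (x : R) :
  is_ring mul -> mul x 0 = 0.
Proof. by move=> Rring; exact: additive0 (ring_mull_additive x Rring). Qed.

Lemma ring_mulNl (R : zmodType) (mul : R -> R -> R) (x y : R) :
  is_ring mul -> mul (- x) y = - mul x y.
Proof. by move=> Rring; exact: additiveN (ring_mulr_additive y Rring) x. Qed.

Lemma ring_mulNr (R : zmodType) (mul : R -> R -> R) (x y : R) :
  is_ring mul -> mul x (- y) = - mul x y.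
Proof. by move=> Rring; exact: additiveN (ring_mull_additive x Rring) y. Qed.

Lemma ring_center_subring (R : zmodType) (mul : R -> R -> R) :
  is_ring mul -> is_subring mul (ring_center mul).
Proof.
move=> Rring; split.
- by move=> x; rewrite (ring_mul0l _ Rring) (ring_mul0r _ Rring).
- move=> r s rC sC x.
  by rewrite (ring_mulDl Rring) (ring_mulDr Rring) (ring_mulNl _ _ Rring)
    (ring_mulNr _ _ Rring) (rC x) (sC x).
- move=> r s rC sC x.
  by rewrite -(ring_mulA Rring) (sC x) (ring_mulA Rring) (rC x) -(ring_mulA Rring).
Qed.

(** * Components of a grading *)

Lemma gradingN (G : groupType) (R : zmodType) (mul : R -> R -> R)
    (Gr : G -> set R) (t : G) (x : R) :
  is_grading mul Gr -> Gr t x -> Gr t (- x).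
Proof.
by move=> grd xt; rewrite -sub0r; apply: (gradingB grd) => //; apply: (grading0 grd).
Qed.

Lemma gradingD (G : groupType) (R : zmodType) (mul : R -> R -> R)
    (Gr : G -> set R) (t : G) (x y : R) :
  is_grading mul Gr -> Gr t x -> Gr t y -> Gr t (x + y).
Proof.
move=> grd xt yt; rewrite -[y]opprK; apply: (gradingB grd) => //.
exact: gradingN grd yt.
Qed.

Lemma grading1_subring (G : groupType) (R : zmodType) (mul : R -> R -> R)
    (Gr : G -> set R) :
  is_grading mul Gr -> is_subring mul (Gr 1%g).
Proof.
move=> grd; split=> [|x y|x y x1 y1].
- exact: grading0 grd _.
- exact: gradingB grd _ _ _.
- by rewrite -(mulg1 1%g); apply: (gradingM grd).
Qed.

(** Listing the degree 1 explicitly, with a zero component if need be, makes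
    the component of degree 1 available without a case distinction. *)
Lemma grading_span1 (G : groupType) (R : zmodType) (mul : R -> R -> R)
    (Gr : G -> set R) (x : R) :
  is_grading mul Gr -> exists s : seq G, exists c : G -> R,
    [/\ uniq s, 1%g \in s, forall t, Gr t (c t) & x = \sum_(t <- s) c t].
Proof.
move=> grd; have [s [c [s_uniq cP xE]]] := grading_span grd x.
have [s1|s1] := boolP (1%g \in s); first by exists s, c.
exists (1%g :: s), (fun t => if t == 1%g then 0 else c t); split=> /=.
- by rewrite s1.
- exact: mem_head.
- by move=> t; case: ifP => _ //; exact: grading0 grd _.
- rewrite big_cons eqxx add0r xE; apply: eq_big_seq => t ts.
  by case: eqP => // t1; rewrite -t1 ts in s1.
Qed.

(** Right multiplication by x of degree a shifts all degrees by a, injectively,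
    so x = sum_t (c t) x is a decomposition into components of distinct
    degrees; as x itself is homogeneous of degree a = 1 * a, the term at t = 1
    is x. *)
Lemma component1_mull (G : groupType) (R : zmodType) (mul : R -> R -> R)
    (Gr : G -> set R) (s : seq G) (c : G -> R) (a : G) (x : R) :
  is_ring mul -> is_grading mul Gr ->
  uniq s -> 1%g \in s -> (forall t, Gr t (c t)) ->
  mul (\sum_(t <- s) c t) x = x -> Gr a x -> mul (c 1%g) x = x.
Proof.
move=> Rring grd s_uniq s1 cP sumx xa.
(* The difference of the two decompositions of x, indexed by actual degree. *)
pose k v := mul (c (v * a^-1)%g) x - (if v == a then x else 0).
have kP v : Gr v (k v).
  apply: (gradingB grd).
    by rewrite -[v in Gr v _](mulgVK a v); apply: (gradingM grd).
  by case: eqP => [->|_] //; exact: grading0 grd _.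
have sa_uniq : uniq [seq (t * a)%g | t <- s].
  by rewrite map_inj_uniq //; exact: mulIg.
have sum_k : \sum_(v <- [seq (t * a)%g | t <- s]) k v = 0.
  rewrite big_map.
  under eq_bigr => t _ do rewrite /k mulgK.
  rewrite sumrB -(big_morph (mul^~ x) (ring_mulr_additive x Rring)
    (ring_mul0l x Rring)) sumx.
  rewrite (bigD1_seq 1%g) //= mul1g eqxx big1 ?addr0 ?subrr // => t t1.
  by rewrite -[X in _ == X]mul1g (inj_eq (mulIg a)) (negbTE t1).
have a_s : a \in [seq (t * a)%g | t <- s].
  by apply/mapP; exists 1%g; rewrite ?mul1g.
have := grading_indep grd sa_uniq kP sum_k a_s.
by rewrite /k eqxx mulgV => /eqP; rewrite subr_eq0 => /eqP.
Qed.

(** The component of degree 1 of an identity u is a left identity, since it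
    fixes every homogeneous element; it therefore coincides with u. *)
Lemma identity_in_Gr1 (G : groupType) (R : zmodType) (mul : R -> R -> R)
    (Gr : G -> set R) (u : R) :
  is_ring mul -> is_grading mul Gr -> is_identity mul u -> Gr 1%g u.
Proof.
move=> Rring grd [mul1x mulx1].
have [s [c [s_uniq s1 cP uE]]] := grading_span1 u grd.
suff <- : mul (c 1%g) u = u by rewrite mulx1; exact: cP.
have [s' [c' [_ c'P ->]]] := grading_span grd u.
rewrite (big_morph _ (ring_mull_additive (c 1%g) Rring)
  (ring_mul0r (c 1%g) Rring)).
apply: eq_bigr => t _.
by apply: (component1_mull Rring grd s_uniq s1 cP _ (c'P t)); rewrite -uE mul1x.
Qed.

(** * Generalized derivations *)

(** Isolates what F and d have in common, so that each closure property needs a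
    single proof, used once for (F, d) and once for (d, d) through [pDerP]. *)
Definition leibniz_pair (G : groupType) (R : zmodType) (mul : R -> R -> R)
    (Gr : G -> set R) (F d : R -> R) : Prop :=
  [/\ {morph F : x y / x + y},
      forall x y, F (mul x y) = mul (F x) y + mul x (d y)
    & forall t x, Gr t x -> Gr t (F x)].

Lemma pDerP (G : groupType) (R : zmodType) (mul : R -> R -> R)
    (Gr : G -> set R) (f : (R -> R) * (R -> R)) :
  pDer mul Gr f <->
  leibniz_pair mul Gr f.1 f.2 /\ leibniz_pair mul Gr f.2 f.2.
Proof. by split=> [[[]]|[[? ? ?] []]]. Qed.

Lemma leibniz_pair0 (G : groupType) (R : zmodType) (mul : R -> R -> R)
    (Gr : G -> set R) :
  is_ring mul -> is_grading mul Gr ->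
  leibniz_pair mul Gr (fun=> 0) (fun=> 0).
Proof.
move=> Rring grd; split=> [x y|x y|t x _]; first by rewrite addr0.
- by rewrite (ring_mul0l _ Rring) (ring_mul0r _ Rring) addr0.
- exact: grading0 grd _.
Qed.

Lemma leibniz_pairN (G : groupType) (R : zmodType) (mul : R -> R -> R)
    (Gr : G -> set R) (F d : R -> R) :
  is_ring mul -> is_grading mul Gr -> leibniz_pair mul Gr F d ->
  leibniz_pair mul Gr (fun x => - F x) (fun x => - d x).
Proof.
move=> Rring grd [FD FM Fgr]; split=> [x y|x y|t x xt].
- by rewrite FD opprD.
- by rewrite FM opprD (ring_mulNl _ _ Rring) (ring_mulNr _ _ Rring).
- by apply: gradingN grd _; exact: Fgr.
Qed.

Lemma leibniz_pairD (G : groupType) (R : zmodType) (mul : R -> R -> R)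
    (Gr : G -> set R) (F1 d1 F2 d2 : R -> R) :
  is_ring mul -> is_grading mul Gr ->
  leibniz_pair mul Gr F1 d1 -> leibniz_pair mul Gr F2 d2 ->
  leibniz_pair mul Gr (fun x => F1 x + F2 x) (fun x => d1 x + d2 x).
Proof.
move=> Rring grd [FD1 FM1 Fgr1] [FD2 FM2 Fgr2]; split=> [x y|x y|t x xt].
- by rewrite FD1 FD2 addrACA.
- by rewrite FM1 FM2 (ring_mulDl Rring) (ring_mulDr Rring) addrACA.
- by apply: gradingD grd _ _; [exact: Fgr1|exact: Fgr2].
Qed.

(** Centrality of r turns r (x d(y)) into x (r d(y)), which is the Leibniz
    rule for r d; degree 1 of r makes x |-> r F(x) preserve degrees. *)
Lemma leibniz_pair_scale (G : groupType) (R : zmodType) (mul : R -> R -> R)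
    (Gr : G -> set R) (r : R) (F d : R -> R) :
  is_ring mul -> is_grading mul Gr -> (ring_center mul `&` Gr 1%g) r ->
  leibniz_pair mul Gr F d ->
  leibniz_pair mul Gr (fun x => mul r (F x)) (fun x => mul r (d x)).
Proof.
move=> Rring grd [rC r1] [FD FM Fgr]; split=> [x y|x y|t x xt].
- by rewrite FD (ring_mulDr Rring).
- by rewrite FM (ring_mulDr Rring) !(ring_mulA Rring) (rC x).
- by rewrite -[t]mul1g; apply: (gradingM grd) => //; exact: Fgr.
Qed.

Lemma eq_fun_pair (T : Type) (f g : (T -> T) * (T -> T)) :
  f.1 =1 g.1 -> f.2 =1 g.2 -> f = g.
Proof. by case: f g => [F d] [F' d'] /= /funext -> /funext ->. Qed.

Lemma pDer_abelian_group (G : groupType) (R : zmodType) (mul : R -> R -> R)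
    (Gr : G -> set R) :
  is_ring mul -> is_grading mul Gr ->
  is_abelian_group_on (pDer mul Gr) (@pDer_add R).
Proof.
move=> Rring grd; split.
- move=> f g /pDerP[f1 f2] /pDerP[g1 g2].
  by apply/pDerP; split; exact: leibniz_pairD.
- by move=> f g h _ _ _; apply: eq_fun_pair => x /=; rewrite addrA.
- by move=> f g _ _; apply: eq_fun_pair => x /=; rewrite addrC.
- exists (fun=> 0, fun=> 0).
    by apply/pDerP; split; exact: leibniz_pair0.
  move=> f /pDerP[f1 f2]; split; first by apply: eq_fun_pair => x /=; rewrite add0r.
  exists (fun x => - f.1 x, fun x => - f.2 x).
    by apply/pDerP; split; exact: leibniz_pairN.
  by apply: eq_fun_pair => x /=; rewrite addNr.
Qed.

Theorem proposition3p6 (G : groupType) (G_abelian : forall s t : G, (s * t)%g = (t * s)%g)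
    (R : zmodType) (mul : R -> R -> R) (R_ring : is_ring mul)
    (Gr : G -> set R) (R_graded : is_grading mul Gr) :
  is_module_on mul (ring_center mul `&` Gr 1%g)
    (pDer mul Gr) (@pDer_add R) (pDer_scale mul) /\
  (forall u : R, is_identity mul u ->
     (ring_center mul `&` Gr 1%g) u /\
     forall f, pDer mul Gr f -> pDer_scale mul u f = f).
Proof.
split; last first.
  move=> u u_id; have [mul1x mulx1] := u_id; split.
    split; last exact: identity_in_Gr1 R_ring R_graded u_id.
    by move=> x; rewrite mul1x mulx1.
  by move=> f _; apply: eq_fun_pair => x /=; rewrite mul1x.
split.
- have [C0 CB CM] := ring_center_subring R_ring.
  have [E0 EB EM] := grading1_subring R_graded.
  split=> [|x y [? ?] [? ?]|x y [? ?] [? ?]] //.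
  + by split; [exact: CB|exact: EB].
  + by split; [exact: CM|exact: EM].
- exact: pDer_abelian_group.
- move=> r f rS /pDerP[f1 f2].
  by apply/pDerP; split; exact: leibniz_pair_scale.
- by move=> r s f _ _ _; apply: eq_fun_pair => x /=; rewrite (ring_mulA R_ring).
- by move=> r s f _ _ _; apply: eq_fun_pair => x /=; rewrite (ring_mulDl R_ring).
- by move=> r f g _ _ _; apply: eq_fun_pair => x /=; rewrite (ring_mulDr R_ring).
Qed.
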